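(* Let $a<0$ and $b<0$, and let $\lambda,\mu>0$ satisfy $$(\lambda a)^2+(\mu b)^2\le\frac12 .$$ Let $u^0\in\mathfrak{H}$ and let $(u^n)_{n\in\mathbb{N}}$ be the sequence of elements of $\mathfrak{H}$ generated by the quarter-space numerical scheme described in the context (Lax-Wendroff scheme on $\mathfrak{I}=\mathbb{N}\times\mathbb{N}$ together with, for all $n\in\mathbb{N}$, the extrapolation boundary conditions $u^n_{-1,k}=u^n_{0,k}$ for $k\in\mathbb{N}$ and $u^n_{j,-1}=u^n_{j,0}$ for $j\in\mathbb{N}$, and the corner condition $u^n_{-1,-1}=u^n_{0,0}$). Then for any $n\in\mathbb{N}$, \begin{align*} \|u^{n+1}\|_{\mathfrak{H}}^2-\|u^n\|_{\mathfrak{H}}^2&+\frac{\lambda|a|}{8}\sum_{k\ge0}(u_{0,k}^n)^2+\frac{\mu|b|}{8}\sum_{j\ge0}(u_{j,0}^n)^2\\ &+\frac{(\mu b)^2}{32}\big((\lambda a)^2+(\mu b)^2\big)\sum_{k\ge0}(\Delta_2u_{0,k}^n)^2+\frac{(\lambda a)^2}{32}\big((\lambda a)^2+(\mu b)^2\big)\sum_{j\ge0}(\Delta_1u_{j,0}^n)^2\le0 . \end{align*} In particular, \begin{align*} \sup_{n\in\mathbb{N}}\|u^n\|_{\mathfrak{H}}^2&+\frac{\lambda|a|}{8}\sum_{n\in\mathbb{N}}\sum_{k\ge0}(u_{0,k}^n)^2+\frac{\mu|b|}{8}\sum_{n\in\mathbb{N}}\sum_{j\ge0}(u_{j,0}^n)^2\\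 &+\frac{(\mu b)^2}{32}\big((\lambda a)^2+(\mu b)^2\big)\sum_{n\in\mathbb{N}}\sum_{k\ge0}(\Delta_2u_{0,k}^n)^2+\frac{(\lambda a)^2}{32}\big((\lambda a)^2+(\mu b)^2\big)\sum_{n\in\mathbb{N}}\sum_{j\ge0}(\Delta_1u_{j,0}^n)^2\le2\,\|u^0\|_{\mathfrak{H}}^2 . \end{align*}
   Context: $\mathbb{N}=\{0,1,2,\dots\}$. Let $\mathfrak{I}=\mathbb{N}\times\mathbb{N}$ (interior indices) and $\mathfrak{J}=(\{-1\}\cup\mathbb{N})^2$. Define $$\mathfrak{H}=\{u\in\ell^2(\mathfrak{J};\mathbb{R}) : u_{-1,k}=u_{0,k}\ \forall k\in\mathbb{N}\cup\{-1\},\ \text{and } u_{j,-1}=u_{j,0}\ \forall j\in\mathbb{N}\}$$ (so in particular $u_{-1,-1}=u_{0,0}$), with norm $\|u\|_{\mathfrak{H}}^2=\sum_{(j,k)\in\mathfrak{I}}u_{j,k}^2$ (only interior values are used). Notation: $\Delta_1u_{j,k}=u_{j+1,k}-2u_{j,k}+u_{j-1,k}$ and $\Delta_2u_{j,k}=u_{j,k+1}-2u_{j,k}+u_{j,k-1}$. Numerical scheme: given $u^n\in\mathfrak{H}$, the values $u^{n+1}_{j,k}$ for $(j,k)\in\mathfrak{I}$ are \begin{align*} u_{j,k}^{n+1} = u_{j,k}^n & - \frac{\lambda a}{2}\big(u_{j+1,k}^n-u_{j-1,k}^n\big) - \frac{\mu b}{2}\big(u_{j,k+1}^n-u_{j,k-1}^n\big)\\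 & + \frac{(\lambda a)^2}{2}\big(u_{j+1,k}^n-2u_{j,k}^n+u_{j-1,k}^n\big) + \frac{(\mu b)^2}{2}\big(u_{j,k+1}^n-2u_{j,k}^n+u_{j,k-1}^n\big)\\ & + \frac{\lambda a\,\mu b}{4}\big(u_{j+1,k+1}^n-u_{j+1,k-1}^n-u_{j-1,k+1}^n+u_{j-1,k-1}^n\big)\\ & - \frac{(\lambda a)^2+(\mu b)^2}{8}\big(u_{j+1,k+1}^n-2u_{j+1,k}^n+u_{j+1,k-1}^n-2u_{j,k+1}^n+4u_{j,k}^n-2u_{j,k-1}^n\\ &\qquad\qquad\qquad\qquad +u_{j-1,k+1}^n-2u_{j-1,k}^n+u_{j-1,k-1}^n\big), \end{align*} and the ghost values ($j=-1$ or $k=-1$) of $u^{n+1}$ are determined by requiring $u^{n+1}\in\mathfrak{H}$. *)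

(* Defs.v *)
From HB Require Import structures.
From mathcomp Require Import all_boot all_order all_algebra.
From mathcomp Require Import all_classical all_reals all_analysis.

Set Implicit Arguments.
Unset Strict Implicit.
Unset Printing Implicit Defensive.

Import Order.TTheory GRing.Theory Num.Theory.
Local Open Scope classical_set_scope.
Local Open Scope ring_scope.

(* A grid function is a total function of two integer indices; its values     *)
(* outside ({-1} U N)^2 are irrelevant: nothing below constrains or uses them. *)
Definition grid (R : realType) := int -> int -> R.

Definition grid_indices : set (int * int) :=
  [set p | (-1 <= p.1)%R /\ (-1 <= p.2)%R].

(* Taking k = -1 in the first clause and j = 0 in the second one gives        *)
(* u (-1) (-1) = u 0 (-1) = u 0 0.                                            *)
Definition extrapolation_conditions (R : realType) (u : grid R) : Prop :=
  (forall k : int, -1 <= k -> u (-1) k = u 0 k) /\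
  (forall j : int, 0 <= j -> u j (-1) = u j 0).

Definition spaceH (R : realType) : set (grid R) :=
  [set u | summable grid_indices (fun p => ((u p.1 p.2) ^+ 2)%:E) /\
           extrapolation_conditions u].

Definition sqnormH (R : realType) (u : grid R) : \bar R :=
  (\esum_(p in [set: nat * nat]) ((u p.1%:Z p.2%:Z) ^+ 2)%:E)%E.

Definition Delta1 (R : realType) (u : grid R) (j k : int) : R :=
  u (j + 1) k - 2 * u j k + u (j - 1) k.

Definition Delta2 (R : realType) (u : grid R) (j k : int) : R :=
  u j (k + 1) - 2 * u j k + u j (k - 1).

Definition lax_wendroff (R : realType) (a b lambda mu : R) (u : grid R)
    (j k : int) : R :=
  u j k
  - (lambda * a) / 2 * (u (j + 1) k - u (j - 1) k)
  - (mu * b) / 2 * (u j (k + 1) - u j (k - 1))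
  + (lambda * a) ^+ 2 / 2 * (u (j + 1) k - 2 * u j k + u (j - 1) k)
  + (mu * b) ^+ 2 / 2 * (u j (k + 1) - 2 * u j k + u j (k - 1))
  + (lambda * a) * (mu * b) / 4 *
    (u (j + 1) (k + 1) - u (j + 1) (k - 1)
     - u (j - 1) (k + 1) + u (j - 1) (k - 1))
  - ((lambda * a) ^+ 2 + (mu * b) ^+ 2) / 8 *
    (u (j + 1) (k + 1) - 2 * u (j + 1) k + u (j + 1) (k - 1)
     - 2 * u j (k + 1) + 4 * u j k - 2 * u j (k - 1)
     + u (j - 1) (k + 1) - 2 * u (j - 1) k + u (j - 1) (k - 1)).

(* Square summability is only required of the initial datum: each step takes  *)
(* finite combinations of shifts and copies interior values to the ghost      *)
(* cells, so it propagates to every u n (in particular every sqnormH (u n)    *)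
(* is finite).                                                                *)
Definition scheme_solution (R : realType) (a b lambda mu : R)
    (u : nat -> grid R) : Prop :=
  [/\ spaceH (u 0%N),
      forall n : nat, extrapolation_conditions (u n) &
      forall n j k : nat,
        u n.+1 j%:Z k%:Z = lax_wendroff a b lambda mu (u n) j%:Z k%:Z].

(* Main.v *)
(* Write one step of the scheme as T u = u - B u - X u, where B = al D1 + be
D2 (al = lambda a, be = mu b) collects the centred first differences. Every
term of |T u|^2 - |u|^2 except (X u)^2 can be summed by parts exactly on the
quarter space; what remains is a quadratic form of the trace on each side, a
corner term, and minus the sum of Q, a weighted sum of squares of the second
differences and of the four mixed differences around a cell. Since the mixed
difference vanishes on the ghost layers, its square has the same sum at each
of the four corners, so the four weights may be chosen freely with a
prescribed total; they are chosen so that (X u)^2 <= 2 (al^2 + be^2) Q is a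
cellwise Cauchy-Schwarz inequality, and the CFL condition makes the right-hand
side at most Q. In a boundary cell two mixed differences vanish, which leaves
a gain Q / 4; it controls the second differences of the trace and absorbs the
unfavourable part of the trace form. No terms at infinity appear because u is
first truncated to a box, which then exhausts the quarter space. *)

Require Import Defs.
From HB Require Import structures.
From mathcomp Require Import all_boot all_order all_algebra.
From mathcomp Require Import all_classical all_reals all_analysis.
From mathcomp Require Import ring lra.

Set Implicit Arguments.
Unset Strict Implicit.
Unset Printing Implicit Defensive.

Import Order.TTheory GRing.Theory Num.Theory.
Local Open Scope classical_set_scope.
Local Open Scope ring_scope.

(** * Summation by parts *)

Section SummationByParts.
Variable R : realFieldType.
Implicit Types (f g : nat -> R) (L : nat).

(* The differences are centred at [i.+1]: index 0 is reserved for the ghost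
   value. *)
Definition cdiff f (i : nat) : R := (f i.+2 - f i) / 2.
Definition lap f (i : nat) : R := f i.+2 - 2 * f i.+1 + f i.
Definition fdiff f (i : nat) : R := f i.+2 - f i.+1.

Definition ghosted L f := [/\ f 0 = f 1, f L = 0 & f L.+1 = 0].

Lemma sum_telescope L (h F : nat -> R) :
  (forall i, F i = h i.+1 - h i) -> \sum_(i < L) F i = h L - h 0.
Proof.
move=> Fh; rewrite -(big_mkord xpredT F) -telescope_sumr //.
by apply: eq_bigr => i _; exact: Fh.
Qed.

Lemma sum_shift L f : f 0 = f L -> \sum_(i < L) f i.+1 = \sum_(i < L) f i.
Proof.
move=> f0L; apply/eqP; rewrite -subr_eq0 -sumrB.
by rewrite (@sum_telescope L f (fun i => f i.+1 - f i))// f0L subrr.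
Qed.

(** Discrete product rule: the summand telescopes through the averaged cross product of neighbours,
    which equals [f 1 * g 1] at the ghost end and 0 at the far end. *)
Lemma sum_by_parts_cdiff L f g : ghosted L f -> ghosted L g ->
  \sum_(i < L) (f i.+1 * cdiff g i + cdiff f i * g i.+1) = - (f 1 * g 1).
Proof.
move=> [f0 fL fL1] [g0 gL gL1].
rewrite (@sum_telescope L (fun i => (f i.+1 * g i + f i * g i.+1) / 2)
  (fun i => f i.+1 * cdiff g i + cdiff f i * g i.+1)); last first.
  by move=> i; rewrite /cdiff; field.
by rewrite /= f0 g0 fL gL; field.
Qed.

Lemma sum_mul_cdiff L f : ghosted L f ->
  \sum_(i < L) f i.+1 * cdiff f i = - (f 1 ^+ 2 / 2).
Proof.
move=> fG; have := sum_by_parts_cdiff fG fG; rewrite big_split /=.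
under [X in _ + X]eq_bigr do rewrite mulrC.
by move=> /eqP; lra.
Qed.

Lemma sum_by_parts_lap L f g : ghosted L f -> ghosted L g ->
  \sum_(i < L) f i.+1 * lap g i = - \sum_(i < L) fdiff f i * fdiff g i.
Proof.
move=> [f0 fL fL1] [g0 gL gL1].
apply/eqP; rewrite -addr_eq0 -big_split /=.
rewrite (@sum_telescope L (fun i => f i.+1 * (g i.+1 - g i))
  (fun i => f i.+1 * lap g i + fdiff f i * fdiff g i)).
  by rewrite /= g0 fL1 subrr !mulr0 mul0r subrr.
by move=> i; rewrite /lap /fdiff; ring.
Qed.

(** With p and q the right and left one-sided differences, the summand is (p^2 - q^2) / 2; it
    telescopes, and the one-sided difference vanishes at both ends. *)
Lemma sum_cdiff_lap L f : ghosted L f -> \sum_(i < L) cdiff f i * lap f i = 0.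
Proof.
move=> [f0 fL fL1].
rewrite (@sum_telescope L (fun i => (f i.+1 - f i) ^+ 2 / 2)
  (fun i => cdiff f i * lap f i)).
  by rewrite /= f0 fL fL1; field.
by move=> i; rewrite /lap /cdiff; field.
Qed.

(** Parallelogram identity: [cdiff] is the half-sum and [lap] the difference of the two one-sided
    differences, and both of these have the same sum of squares. *)
Lemma sum_cdiff_sqr L f : ghosted L f -> \sum_(i < L) cdiff f i ^+ 2 =
  \sum_(i < L) fdiff f i ^+ 2 - (\sum_(i < L) lap f i ^+ 2) / 4.
Proof.
move=> [f0 fL fL1]; apply/eqP; rewrite eq_sym -subr_eq0 mulr_suml -!sumrB.
rewrite (@sum_telescope L (fun i => (f i.+1 - f i) ^+ 2 / 2)
  (fun i => fdiff f i ^+ 2 - lap f i ^+ 2 / 4 - cdiff f i ^+ 2)).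
  by rewrite /= f0 fL fL1; apply/eqP; field.
by move=> i; rewrite /lap /cdiff /fdiff; field.
Qed.

(** This combination pairs a second-order term of -2 u X u with a square coming from (B u)^2; the
    [fdiff] sums cancel and only dissipation is left. *)
Lemma sum_mul_lap_add_cdiff_sqr L f : ghosted L f ->
  \sum_(i < L) (f i.+1 * lap f i + cdiff f i ^+ 2) =
  - ((\sum_(i < L) lap f i ^+ 2) / 4).
Proof.
move=> fG; rewrite big_split /= sum_by_parts_lap// sum_cdiff_sqr//.
under [in X in - X]eq_bigr do rewrite -expr2.
ring.
Qed.

Lemma sum_lap_sqr_le L f : ghosted L f ->
  \sum_(i < L) lap f i ^+ 2 <= 4 * \sum_(i < L) fdiff f i ^+ 2.
Proof.
move=> [f0 fL fL1].
have <- : \sum_(i < L) (2 * fdiff f i ^+ 2 + 2 * (f i.+1 - f i) ^+ 2)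
    = 4 * \sum_(i < L) fdiff f i ^+ 2.
  rewrite big_split /= -!mulr_sumr.
  rewrite -(@sum_shift L (fun i => (f i.+1 - f i) ^+ 2)); last first.
    by rewrite f0 fL fL1 !subrr.
  rewrite /fdiff; ring.
apply: ler_sum => i _; rewrite /lap /fdiff.
by have := sqr_ge0 (f i.+2 - f i); nra.
Qed.

Lemma sum_fdiff_sqr_le L f : ghosted L f ->
  \sum_(i < L) fdiff f i ^+ 2 <= 4 * \sum_(i < L) f i.+1 ^+ 2.
Proof.
move=> [f0 fL fL1].
apply: (@le_trans _ _
  (\sum_(i < L) (2 * f i.+2 ^+ 2 + 2 * f i.+1 ^+ 2))).
  apply: ler_sum => i _; rewrite /fdiff.
  by have := sqr_ge0 (f i.+2 + f i.+1); nra.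
rewrite big_split /= -!mulr_sumr.
suff : \sum_(i < L) f i.+2 ^+ 2 <= \sum_(i < L) f i.+1 ^+ 2 by lra.
rewrite -subr_ge0 -sumrB -oppr_le0 -sumrN.
rewrite (@sum_telescope L (fun i => f i.+1 ^+ 2)
  (fun i => - (f i.+1 ^+ 2 - f i.+2 ^+ 2))); last by move=> i; ring.
by rewrite fL1 expr0n /= sub0r oppr_le0 sqr_ge0.
Qed.

Lemma first_sqr_le_sum L f : ghosted L f ->
  f 1 ^+ 2 <= \sum_(i < L) f i.+1 ^+ 2.
Proof.
case: L => [[f0 fL _]|L _]; first by rewrite -f0 fL expr0n big_ord0.
by rewrite big_ord_recl lerDl; apply: sumr_ge0 => i _; exact: sqr_ge0.
Qed.

End SummationByParts.

(** * Sums over a square box and summation by parts in two variables *)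

Section GridSums.
Variable R : realFieldType.
Implicit Types (v F G : nat -> nat -> R) (L : nat).

Definition gsum L F : R := \sum_(j < L) \sum_(k < L) F j k.

Lemma eq_gsum L F G : (forall j k, F j k = G j k) -> gsum L F = gsum L G.
Proof. by move=> FG; apply: eq_bigr => j _; apply: eq_bigr => k _. Qed.

Lemma ler_gsum L F G : (forall j k, F j k <= G j k) -> gsum L F <= gsum L G.
Proof. by move=> FG; apply: ler_sum => j _; apply: ler_sum => k _. Qed.

Lemma gsumD L F G : gsum L (fun j k => F j k + G j k) = gsum L F + gsum L G.
Proof.
by rewrite /gsum -big_split /=; apply: eq_bigr => j _; rewrite big_split.
Qed.

Lemma gsumZ L (c : R) F : gsum L (fun j k => c * F j k) = c * gsum L F.
Proof.
by rewrite /gsum mulr_sumr; apply: eq_bigr => j _; rewrite mulr_sumr.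
Qed.

Lemma gsum_tr L F : gsum L F = gsum L (fun j k => F k j).
Proof. by rewrite /gsum exchange_big. Qed.

Definition D1 v j k := cdiff (v^~ k.+1) j.
Definition D2 v j k := cdiff (v j.+1) k.
Definition L1 v j k := lap (v^~ k.+1) j.
Definition L2 v j k := lap (v j.+1) k.
Definition D12 v j k := cdiff (fun i => cdiff (v i) k) j.
Definition L12 v j k := lap (fun i => lap (v i) k) j.
(** The four mixed differences around the node [(j.+1, k.+1)] are those with [i] equal to [j] or
    [j.+1] and [l] equal to [k] or [k.+1]. *)
Definition mixed v i l := v i.+1 l.+1 - v i.+1 l - v i l.+1 + v i l.

Definition ghosted2 L v :=
  (forall k, ghosted L (v^~ k)) /\ (forall j, ghosted L (v j)).

Variables (L : nat) (v : nat -> nat -> R).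
Hypothesis vG : ghosted2 L v.

Lemma ghosted2_tr : ghosted2 L (fun i k => v k i).
Proof. by case: vG. Qed.


Lemma ghosted_cdiff1 j : ghosted L (fun k => cdiff (v^~ k) j).
Proof.
case: (vG.2 j.+2) (vG.2 j) => [e1 e2 e3] [e4 e5 e6].
by split; rewrite /cdiff ?(e1, e2, e3, e4, e5, e6) ?subrr ?mul0r.
Qed.

Lemma ghosted_cdiff2 k : ghosted L (fun j => cdiff (v j) k).
Proof.
case: (vG.1 k.+2) (vG.1 k) => [e1 e2 e3] [e4 e5 e6].
by split; rewrite /cdiff ?(e1, e2, e3, e4, e5, e6) ?subrr ?mul0r.
Qed.

Lemma ghosted_lap2 k : ghosted L (fun j => lap (v j) k).
Proof.
case: (vG.1 k.+2) (vG.1 k.+1) (vG.1 k) => [e1 e2 e3] [e4 e5 e6] [e7 e8 e9].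
split; rewrite /lap ?(e1, e2, e3, e4, e5, e6, e7, e8, e9);
  by rewrite ?mulr0 ?subrr ?addr0.
Qed.

Lemma ghosted_lap1 j : ghosted L (fun k => lap (v^~ k) j).
Proof.
case: (vG.2 j.+2) (vG.2 j.+1) (vG.2 j) => [e1 e2 e3] [e4 e5 e6] [e7 e8 e9].
split; rewrite /lap ?(e1, e2, e3, e4, e5, e6, e7, e8, e9);
  by rewrite ?mulr0 ?subrr ?addr0.
Qed.

Lemma ghosted_fdiff2 k : ghosted L (fun j => fdiff (v j) k).
Proof.
case: (vG.1 k.+2) (vG.1 k.+1) => [e1 e2 e3] [e4 e5 e6].
by split; rewrite /fdiff ?(e1, e2, e3, e4, e5, e6) ?subrr.
Qed.

Lemma ghosted_fdiff1 j : ghosted L (fun k => fdiff (v^~ k) j).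
Proof.
case: (vG.2 j.+2) (vG.2 j.+1) => [e1 e2 e3] [e4 e5 e6].
by split; rewrite /fdiff ?(e1, e2, e3, e4, e5, e6) ?subrr.
Qed.

Lemma gsum_mul_D1 : gsum L (fun j k => v j.+1 k.+1 * D1 v j k) =
  - ((\sum_(k < L) v 1 k.+1 ^+ 2) / 2).
Proof.
rewrite /gsum exchange_big mulr_suml -sumrN; apply: eq_bigr => k _.
exact: (sum_mul_cdiff (vG.1 k.+1)).
Qed.

Lemma gsum_mul_L1_add_D1_sqr :
  gsum L (fun j k => v j.+1 k.+1 * L1 v j k + D1 v j k ^+ 2) =
  - (gsum L (fun j k => L1 v j k ^+ 2) / 4).
Proof.
rewrite /gsum exchange_big [in RHS]exchange_big mulr_suml -sumrN.
by apply: eq_bigr => k _; exact: (sum_mul_lap_add_cdiff_sqr (vG.1 k.+1)).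
Qed.

Lemma gsum_D1_L1 : gsum L (fun j k => D1 v j k * L1 v j k) = 0.
Proof.
rewrite /gsum exchange_big big1//= => k _.
exact: (sum_cdiff_lap (vG.1 k.+1)).
Qed.

Lemma gsum_mul_D12_add_D1_D2 :
  gsum L (fun j k => v j.+1 k.+1 * D12 v j k + D1 v j k * D2 v j k) =
  v 1 1 ^+ 2 / 2.
Proof.
rewrite /gsum exchange_big /=.
under eq_bigr => k _ do
  rewrite (sum_by_parts_cdiff (vG.1 k.+1) (ghosted_cdiff2 k)).
by rewrite sumrN (sum_mul_cdiff (vG.2 1)) opprK.
Qed.

(** Summing by parts in [k] leaves, for each [k], a product f D1 f with f the first difference in
    [k]; its sum over [j] is a boundary value, so only the trace survives. *)
Lemma gsum_D1_L2 : gsum L (fun j k => D1 v j k * L2 v j k) =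
  (\sum_(k < L) fdiff (v 1) k ^+ 2) / 2.
Proof.
rewrite /gsum.
under eq_bigr => j _ do
  rewrite (sum_by_parts_lap (ghosted_cdiff1 j) (vG.2 j.+1)).
rewrite sumrN exchange_big -sumrN mulr_suml; apply: eq_bigr => k _ /=.
rewrite -[RHS]opprK -(sum_mul_cdiff (ghosted_fdiff2 k)); congr -%R.
by apply: eq_bigr => j _; rewrite /cdiff /fdiff; field.
Qed.

Lemma gsum_D1_D12 : gsum L (fun j k => D1 v j k * D12 v j k) =
  - ((\sum_(j < L) cdiff (v^~ 1) j ^+ 2) / 2).
Proof.
rewrite /gsum mulr_suml -sumrN; apply: eq_bigr => j _.
rewrite -(sum_mul_cdiff (ghosted_cdiff1 j)); apply: eq_bigr => k _.
by rewrite /D1 /D12 /cdiff; field.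
Qed.

(** After summation by parts in [k], the sum over [j] has the form treated in [sum_cdiff_lap]. *)
Lemma gsum_D1_L12 : gsum L (fun j k => D1 v j k * L12 v j k) = 0.
Proof.
rewrite /gsum.
transitivity (\sum_(j < L) \sum_(k < L)
  cdiff (v^~ k.+1) j * lap (fun k => lap (v^~ k) j) k).
  apply: eq_bigr => j _; apply: eq_bigr => k _.
  by rewrite /D1 /L12 /lap; ring.
under eq_bigr => j _ do
  rewrite (sum_by_parts_lap (ghosted_cdiff1 j) (ghosted_lap1 j)).
rewrite sumrN exchange_big big1 ?oppr0//= => k _.
apply: etrans (sum_cdiff_lap (ghosted_fdiff2 k)); apply: eq_bigr => j _.
by rewrite /cdiff /fdiff /lap; field.
Qed.

(** One summation by parts in each direction; the ghost conditions cancel the boundary terms both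
    times. *)
Lemma gsum_mul_L12 : gsum L (fun j k => v j.+1 k.+1 * L12 v j k) =
  gsum L (fun j k => mixed v j.+1 k.+1 ^+ 2).
Proof.
rewrite /gsum exchange_big /=.
under eq_bigr => k _ do
  rewrite (sum_by_parts_lap (vG.1 k.+1) (ghosted_lap2 k)).
rewrite sumrN exchange_big /= -sumrN; apply: eq_bigr => j _.
transitivity (- \sum_(k < L)
    (fun k => fdiff (v^~ k) j) k.+1 * lap (fun k => fdiff (v^~ k) j) k).
  congr -%R; apply: eq_bigr => k _; congr *%R.
  by rewrite /fdiff /lap; ring.
rewrite (sum_by_parts_lap (ghosted_fdiff1 j) (ghosted_fdiff1 j)) opprK.
by apply: eq_bigr => k _; rewrite /fdiff /mixed; ring.
Qed.

Lemma mixed_ghost1 k : mixed v 0 k = 0 /\ mixed v L k = 0.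
Proof.
case: (vG.1 k.+1) (vG.1 k) => [e1 e2 e3] [e4 e5 e6].
by rewrite /mixed e1 e2 e3 e4 e5 e6; split; ring.
Qed.

Lemma mixed_ghost2 j : mixed v j 0 = 0 /\ mixed v j L = 0.
Proof.
case: (vG.2 j.+1) (vG.2 j) => [e1 e2 e3] [e4 e5 e6].
by rewrite /mixed e1 e2 e3 e4 e5 e6; split; ring.
Qed.

(** The offset [l] is taken to be 0 or 1, so that the shifts in the two directions chain together
    and identify the sums at all four corners of a cell. *)
Lemma gsum_mixed_shift1 l : gsum L (fun j k => mixed v j.+1 (l + k) ^+ 2) =
  gsum L (fun j k => mixed v j (l + k) ^+ 2).
Proof.
rewrite /gsum exchange_big [RHS]exchange_big; apply: eq_bigr => k _ /=.
apply: (@sum_shift _ L (fun j => mixed v j (l + k) ^+ 2)).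
by case: (mixed_ghost1 (l + k)) => -> ->.
Qed.

Lemma gsum_mixed_shift2 l : gsum L (fun j k => mixed v (l + j) k.+1 ^+ 2) =
  gsum L (fun j k => mixed v (l + j) k ^+ 2).
Proof.
apply: eq_bigr => j _ /=.
apply: (@sum_shift _ L (fun k => mixed v (l + j) k ^+ 2)).
by case: (mixed_ghost2 (l + j)) => -> ->.
Qed.

End GridSums.

(** * Exact energy balance of one step on a box *)

Section EnergyOnBox.
Variable R : realFieldType.
Variables (L : nat) (v : nat -> nat -> R).
Hypothesis vG : ghosted2 L v.
Let vT i k := v k i.
Let vTG : ghosted2 L vT := ghosted2_tr vG.

(** The identities in the second direction are those in the first one, applied to the transposed
    grid. *)
Lemma gsum_mul_D2 : gsum L (fun j k => v j.+1 k.+1 * D2 v j k) =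
  - ((\sum_(j < L) v j.+1 1 ^+ 2) / 2).
Proof. by rewrite -(gsum_mul_D1 vTG) gsum_tr. Qed.

Lemma gsum_mul_L2_add_D2_sqr :
  gsum L (fun j k => v j.+1 k.+1 * L2 v j k + D2 v j k ^+ 2) =
  - (gsum L (fun j k => L2 v j k ^+ 2) / 4).
Proof.
by rewrite [in RHS]gsum_tr -(gsum_mul_L1_add_D1_sqr vTG) gsum_tr.
Qed.

Lemma gsum_D2_L2 : gsum L (fun j k => D2 v j k * L2 v j k) = 0.
Proof. by rewrite -(gsum_D1_L1 vTG) gsum_tr. Qed.

Lemma gsum_D2_L1 : gsum L (fun j k => D2 v j k * L1 v j k) =
  (\sum_(j < L) fdiff (v^~ 1) j ^+ 2) / 2.
Proof. by rewrite -(gsum_D1_L2 vTG) gsum_tr. Qed.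

Lemma gsum_D2_D12 : gsum L (fun j k => D2 v j k * D12 v j k) =
  - ((\sum_(k < L) cdiff (v 1) k ^+ 2) / 2).
Proof.
rewrite -(gsum_D1_D12 vTG) gsum_tr; apply: eq_gsum => j k; congr *%R.
by rewrite /D12 /cdiff /vT; field.
Qed.

Lemma gsum_D2_L12 : gsum L (fun j k => D2 v j k * L12 v j k) = 0.
Proof.
rewrite -(gsum_D1_L12 vTG) gsum_tr; apply: eq_gsum => j k; congr *%R.
by rewrite /L12 /lap /vT; ring.
Qed.

Definition lwX (al be : R) j k : R :=
  - (al ^+ 2 / 2 * L1 v j k) - be ^+ 2 / 2 * L2 v j k - al * be * D12 v j k
  + (al ^+ 2 + be ^+ 2) / 8 * L12 v j k.

Definition lw (al be : R) j k : R :=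
  v j.+1 k.+1 - (al * D1 v j k + be * D2 v j k) - lwX al be j k.

(** Up to sign, [lwX] has coefficient (al - be)^2 / 8 on one diagonal pair of mixed differences and
    (al + be)^2 / 8 on the other; the weights here are half of these. *)
Definition lwQ (al be : R) j k : R :=
  al ^+ 2 / 4 * L1 v j k ^+ 2 + be ^+ 2 / 4 * L2 v j k ^+ 2
  + (al - be) ^+ 2 / 16 * (mixed v j.+1 k.+1 ^+ 2 + mixed v j k ^+ 2)
  + (al + be) ^+ 2 / 16 * (mixed v j.+1 k ^+ 2 + mixed v j k.+1 ^+ 2).

(** The four corner sums coincide and their weights add up to (al^2 + be^2) / 4, the coefficient
    that -2 u X u produces through [gsum_mul_L12]. *)
Lemma gsum_lwQ al be : gsum L (lwQ al be) =
  al ^+ 2 / 4 * gsum L (fun j k => L1 v j k ^+ 2)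
  + be ^+ 2 / 4 * gsum L (fun j k => L2 v j k ^+ 2)
  + (al ^+ 2 + be ^+ 2) / 4 * gsum L (fun j k => mixed v j.+1 k.+1 ^+ 2).
Proof.
rewrite /lwQ !(gsumD, gsumZ).
rewrite -(gsum_mixed_shift2 vG 0) -(gsum_mixed_shift1 vG 1).
rewrite -(gsum_mixed_shift2 vG 1).
by field.
Qed.

Lemma gsum_lw_sqr al be :
  gsum L (fun j k => lw al be j k ^+ 2)
    - gsum L (fun j k => v j.+1 k.+1 ^+ 2) =
  al * \sum_(k < L) v 1 k.+1 ^+ 2 + be * \sum_(j < L) v j.+1 1 ^+ 2
  + al * be * v 1 1 ^+ 2
  + al * be ^+ 2 / 4 * (2 * \sum_(k < L) fdiff (v 1) k ^+ 2
                        - \sum_(k < L) lap (v 1) k ^+ 2)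
  + al ^+ 2 * be / 4 * (2 * \sum_(j < L) fdiff (v^~ 1) j ^+ 2
                        - \sum_(j < L) lap (v^~ 1) j ^+ 2)
  - gsum L (lwQ al be) + gsum L (fun j k => lwX al be j k ^+ 2).
Proof.
set s := al ^+ 2 + be ^+ 2.
(* The square is expanded and grouped so that every summand other than the energy density and the
   square of [lwX] matches one of the summation identities. *)
have -> : gsum L (fun j k => lw al be j k ^+ 2) =
  gsum L (fun j k => v j.+1 k.+1 ^+ 2
    + (- 2 * al) * (v j.+1 k.+1 * D1 v j k)
    + (- 2 * be) * (v j.+1 k.+1 * D2 v j k)
    + al ^+ 2 * (v j.+1 k.+1 * L1 v j k + D1 v j k ^+ 2)
    + be ^+ 2 * (v j.+1 k.+1 * L2 v j k + D2 v j k ^+ 2)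
    + (2 * al * be) * (v j.+1 k.+1 * D12 v j k + D1 v j k * D2 v j k)
    + (- s / 4) * (v j.+1 k.+1 * L12 v j k)
    + (- al ^+ 3) * (D1 v j k * L1 v j k)
    + (- al * be ^+ 2) * (D1 v j k * L2 v j k)
    + (- al ^+ 2 * be) * (D2 v j k * L1 v j k)
    + (- be ^+ 3) * (D2 v j k * L2 v j k)
    + (- 2 * al ^+ 2 * be) * (D1 v j k * D12 v j k)
    + (- 2 * al * be ^+ 2) * (D2 v j k * D12 v j k)
    + (al * s / 4) * (D1 v j k * L12 v j k)
    + (be * s / 4) * (D2 v j k * L12 v j k)
    + lwX al be j k ^+ 2).
  by apply: eq_gsum => j k; rewrite /lw /lwX /s; field.
rewrite 15!gsumD !gsumZ (gsum_mul_D1 vG) gsum_mul_D2.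
rewrite (gsum_mul_L1_add_D1_sqr vG) gsum_mul_L2_add_D2_sqr.
rewrite (gsum_mul_D12_add_D1_D2 vG) (gsum_mul_L12 vG).
rewrite (gsum_D1_L1 vG) gsum_D2_L2 (gsum_D1_L2 vG) gsum_D2_L1.
rewrite (gsum_D1_D12 vG) gsum_D2_D12 (gsum_D1_L12 vG) gsum_D2_L12.
(* The centred differences of the traces, left by the products with [D12], become first and second
   differences. *)
rewrite (sum_cdiff_sqr (vG.1 1)) (sum_cdiff_sqr (vG.2 1)) gsum_lwQ /s.
by field.
Qed.

End EnergyOnBox.

(** * Energy inequality for finitely supported grids *)

Section EnergyInequalityOnBox.
Variable R : realFieldType.

(** Weighted Cauchy-Schwarz for a list of pairs (weight, value), in a form that allows zero
    weights. *)
Lemma weighted_sum_sqr_le (r : seq (R * R)) : all (fun p => 0 <= p.1) r ->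
  (\sum_(p <- r) p.1 * p.2) ^+ 2 <=
  (\sum_(p <- r) p.1) * \sum_(p <- r) p.1 * p.2 ^+ 2.
Proof.
elim: r => [_|[w t] r IHr /= /andP[w0 r0]].
  by rewrite !big_nil mul0r expr0n.
have := IHr r0; rewrite !big_cons /=.
set Y := \sum_(p <- r) p.1 * p.2; set W := \sum_(p <- r) p.1.
set V := \sum_(p <- r) _ => YWV.
have W0 : 0 <= W.
  rewrite /W big_seq; apply: sumr_ge0 => p pr; exact: (allP r0).
have V0 : 0 <= V.
  rewrite /V big_seq; apply: sumr_ge0 => p pr.
  by rewrite mulr_ge0 ?sqr_ge0//; exact: (allP r0).
(* A quadratic in [t] whose discriminant is nonpositive by the induction hypothesis; if [W] is 0,
   that hypothesis forces [Y] to be 0. *)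
suff : 0 <= W * t ^+ 2 - 2 * Y * t + V by nra.
have [W_gt0|/eqP We0] : 0 < W \/ W == 0 by apply/orP; rewrite orbC -le0r.
  rewrite -(pmulr_rge0 _ W_gt0).
  have -> : W * (W * t ^+ 2 - 2 * Y * t + V) =
    (W * t - Y) ^+ 2 + (W * V - Y ^+ 2) by ring.
  by rewrite addr_ge0 ?sqr_ge0// subr_ge0.
have /eqP -> : Y == 0.
  by rewrite -sqrf_eq0 eq_le sqr_ge0 andbT (le_trans YWV)// We0 mul0r.
by rewrite We0; lra.
Qed.

Variables al be : R.
Hypothesis CFL : al ^+ 2 + be ^+ 2 <= 1 / 2.

(** * Bounds on the remainder in a single cell *)

Section OneCell.
Variables (L : nat) (v : nat -> nat -> R).
Hypothesis vG : ghosted2 L v.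
Implicit Types j k : nat.

Lemma D12_mixed j k : D12 v j k = (mixed v j.+1 k.+1 + mixed v j k
  + mixed v j.+1 k + mixed v j k.+1) / 4.
Proof. by rewrite /D12 /cdiff /mixed; field. Qed.

Lemma L12_mixed j k : L12 v j k = mixed v j.+1 k.+1 + mixed v j k
  - mixed v j.+1 k - mixed v j k.+1.
Proof. by rewrite /L12 /lap /mixed; ring. Qed.


Lemma lwQ_ge j k : al ^+ 2 / 4 * L1 v j k ^+ 2 + be ^+ 2 / 4 * L2 v j k ^+ 2
  <= lwQ v al be j k.
Proof.
rewrite /lwQ -addrA lerDl.
by rewrite addr_ge0// mulr_ge0 ?addr_ge0 ?divr_ge0 ?sqr_ge0.
Qed.

Lemma lwQ_ge0 j k : 0 <= lwQ v al be j k.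
Proof.
apply: le_trans (lwQ_ge j k).
by rewrite addr_ge0// mulr_ge0 ?divr_ge0 ?sqr_ge0.
Qed.

(* Cauchy-Schwarz: the weights of the differences in [lwX] add up to
   al^2 + be^2, and [lwQ] is half the corresponding weighted sum of squares. *)
Lemma lwX_sqr_le j k : lwX v al be j k ^+ 2 <= lwQ v al be j k.
Proof.
have s2 : 2 * (al ^+ 2 + be ^+ 2) <= 1 by move: CFL; lra.
have := lwQ_ge0 j k; rewrite /lwX /lwQ D12_mixed L12_mixed.
set x := L1 v j k; set y := L2 v j k.
set m1 := mixed v j.+1 k.+1; set m2 := mixed v j k.
set m3 := mixed v j.+1 k; set m4 := mixed v j k.+1.
have := @weighted_sum_sqr_le [:: (al ^+ 2 / 2, - x); (be ^+ 2 / 2, - y);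
  ((al - be) ^+ 2 / 8, m1); ((al - be) ^+ 2 / 8, m2);
  ((al + be) ^+ 2 / 8, - m3); ((al + be) ^+ 2 / 8, - m4)].
rewrite /= !divr_ge0 ?sqr_ge0// !big_cons !big_nil /= => /(_ isT) CS.
set Q := (X in 0 <= X -> _); set X := (X in X ^+ 2 <= _) => Q0.
have XQ : X ^+ 2 <= 2 * (al ^+ 2 + be ^+ 2) * Q by rewrite /X /Q; lra.
by apply: le_trans XQ _; exact: ler_piMl.
Qed.

(* Next to the boundary two mixed differences vanish, and with them one quarter
   of the total weight. *)
Lemma lwX_sqr_le_boundary j k : mixed v j k = 0 ->
    mixed v j k.+1 = 0 \/ mixed v j.+1 k = 0 ->
  lwX v al be j k ^+ 2 <= 3 / 4 * lwQ v al be j k.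
Proof.
move=> m20 m340.
have s2 : 3 / 2 * (al ^+ 2 + be ^+ 2) <= 3 / 4 by move: CFL; lra.
have := lwQ_ge0 j k; rewrite /lwX /lwQ D12_mixed L12_mixed m20.
set x := L1 v j k; set y := L2 v j k; set m1 := mixed v j.+1 k.+1.
(* One of the two summands vanishes, so [m] is the other one; using the sum treats both kinds of
   boundary cell at once. *)
set m := mixed v j.+1 k + mixed v j k.+1.
have mD : mixed v j k.+1 = m - mixed v j.+1 k by rewrite addrAC subrr add0r.
have m2E : mixed v j.+1 k ^+ 2 + (m - mixed v j.+1 k) ^+ 2 = m ^+ 2.
  rewrite -mD /m; case: m340 => ->; rewrite ?addr0 ?add0r expr0n /=;
  by rewrite ?addr0 ?add0r.
have := @weighted_sum_sqr_le [:: (al ^+ 2 / 2, - x); (be ^+ 2 / 2, - y);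
  ((al - be) ^+ 2 / 8, m1); ((al + be) ^+ 2 / 8, - m)].
rewrite /= !divr_ge0 ?sqr_ge0// !big_cons !big_nil /= => /(_ isT) CS.
rewrite mD m2E.
set Q := (X in 0 <= X -> _); set X := (X in X ^+ 2 <= _) => Q0.
have XQ : X ^+ 2 <= 3 / 2 * (al ^+ 2 + be ^+ 2) * Q by rewrite /X /Q; lra.
by apply: le_trans XQ _; exact: ler_wpM2r.
Qed.

(** A quarter of [lwQ] dominates both extra squares together, so the corner cell, where both
    indicators are 1, is covered by a single gain. *)
Lemma lwX_sqr_le_gain j k : lwX v al be j k ^+ 2
    + (j == 0)%:R * (be ^+ 2 / 16 * L2 v j k ^+ 2)
    + (k == 0)%:R * (al ^+ 2 / 16 * L1 v j k ^+ 2) <= lwQ v al be j k.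
Proof.
have Q_ge := lwQ_ge j k.
have x0 : 0 <= al ^+ 2 * L1 v j k ^+ 2 by rewrite mulr_ge0 ?sqr_ge0.
have y0 : 0 <= be ^+ 2 * L2 v j k ^+ 2 by rewrite mulr_ge0 ?sqr_ge0.
have [j0|j0] := eqVneq j 0.
  have XQ : lwX v al be j k ^+ 2 <= 3 / 4 * lwQ v al be j k.
    have [? _] := mixed_ghost1 vG k; have [? _] := mixed_ghost1 vG k.+1.
    by apply: lwX_sqr_le_boundary; rewrite j0; auto.
  by case: eqP => _; rewrite ?mul1r ?mul0r; lra.
have [k0|k0] := eqVneq k 0.
  have XQ : lwX v al be j k ^+ 2 <= 3 / 4 * lwQ v al be j k.
    have [? _] := mixed_ghost2 vG j; have [? _] := mixed_ghost2 vG j.+1.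
    by apply: lwX_sqr_le_boundary; rewrite k0; auto.
  by rewrite mul1r mul0r; lra.
by rewrite !mul0r !addr0; exact: lwX_sqr_le.
Qed.

Lemma gsum_row0 (F : nat -> nat -> R) :
  gsum L (fun j k => (j == 0)%:R * F j k) = \sum_(k < L) F 0 k.
Proof.
rewrite /gsum; case: L => [|M]; first by rewrite !big_ord0.
rewrite big_ord_recl [X in _ + X]big1 ?addr0.
  by apply: eq_bigr => k _; rewrite mul1r.
by move=> j _; rewrite big1// => k _; rewrite mul0r.
Qed.

Lemma gsum_col0 (F : nat -> nat -> R) :
  gsum L (fun j k => (k == 0)%:R * F j k) = \sum_(j < L) F j 0.
Proof. by rewrite gsum_tr (gsum_row0 (fun j k => F k j)). Qed.

Lemma gsum_lwX_sqr_le : gsum L (fun j k => lwX v al be j k ^+ 2)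
    + be ^+ 2 / 16 * \sum_(k < L) lap (v 1) k ^+ 2
    + al ^+ 2 / 16 * \sum_(j < L) lap (v^~ 1) j ^+ 2 <= gsum L (lwQ v al be).
Proof.
rewrite !mulr_sumr -(gsum_row0 (fun j k => be ^+ 2 / 16 * L2 v j k ^+ 2)).
rewrite -(gsum_col0 (fun j k => al ^+ 2 / 16 * L1 v j k ^+ 2)) -!gsumD.
by apply: ler_gsum => j k; exact: lwX_sqr_le_gain.
Qed.

End OneCell.

(* [W], [G], [D] stand for the sums of squares of a trace and of its first and
   second differences, [z] for its squared corner value. *)
Lemma trace_quadratic_le (A B W G D z : R) : 0 <= A -> 0 <= B ->
    A ^+ 2 + B ^+ 2 <= 1 / 2 -> 0 <= D <= 4 * G -> G <= 4 * W -> 0 <= z <= W ->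
  - A * W - A * B ^+ 2 / 4 * (2 * G - D) - B ^+ 2 / 16 * D + A * B / 2 * z
  <= - (A / 8 * W) - B ^+ 2 / 32 * (A ^+ 2 + B ^+ 2) * D.
Proof.
move=> A0 B0 AB /andP[D0 DG] GW /andP[z0 zW].
have A2 := sqr_ge0 A; have B2 : B ^+ 2 <= 1 / 2 by lra.
(* 18/25 is a rational upper bound for the square root of 1/2. *)
have B1 : B <= 18 / 25.
  by rewrite leNgt; apply/negP => Bgt; nra.
have ABz : A * B / 2 * z <= A * (9 / 25) * W.
  have Bz : B * z <= 18 / 25 * W by exact: ler_pM.
  by have := ler_wpM2l A0 Bz; lra.
have sD : B ^+ 2 / 32 * (A ^+ 2 + B ^+ 2) * D <= B ^+ 2 / 64 * D.
  by apply: ler_wpM2r => //; have := ler_wpM2l (sqr_ge0 B) AB; lra.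
have AGD : A * B ^+ 2 * D <= A * B ^+ 2 * (4 * G).
  by apply: ler_wpM2l => //; rewrite mulr_ge0 ?sqr_ge0.
have W0 : 0 <= W by lra.
have AW0 : 0 <= A * W by exact: mulr_ge0.
(* Since D <= 4 G, the term with 2 G - D contributes at most A B^2 D / 8; -1/16 + 1/64 gives -3/64,
   and A W keeps the factor 1 - 9/25 - 1/8 > 1/2. *)
suff : B ^+ 2 * (A / 8 - 3 / 64) * D <= A / 2 * W by lra.
(* Up to 3/8 the coefficient of [D] is nonpositive; beyond it, D <= 4 G <= 16 W is used. *)
have [A_small|A_big] := leP A (3 / 8).
  apply: (@le_trans _ _ 0); last by rewrite !mulr_ge0// divr_ge0.
  rewrite mulr_le0_ge0// mulr_ge0_le0 ?sqr_ge0//; lra.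
apply: (@le_trans _ _ (B ^+ 2 * (A / 8 - 3 / 64) * (16 * W))).
  by apply: ler_wpM2l; [rewrite mulr_ge0 ?sqr_ge0//; lra|lra].
suff : B ^+ 2 * (2 * A - 3 / 4) <= A / 2.
  by move/(ler_wpM2r W0); lra.
have A1 : A <= 18 / 25.
  by rewrite leNgt; apply/negP => Agt; have := sqr_ge0 B; nra.
(* A > 3/8 leaves at most 1/2 - 9/64 = 23/64 < 9/25 for B^2. *)
have B3 : B ^+ 2 <= 9 / 25.
  suff : 9 / 64 <= A ^+ 2 by lra.
  by rewrite expr2; nra.
apply: (@le_trans _ _ (9 / 25 * (2 * A - 3 / 4))); last by lra.
by apply: ler_wpM2r => //; lra.
Qed.

Lemma energy_inequality_on_box (L : nat) (v : nat -> nat -> R) :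
    ghosted2 L v -> al <= 0 -> be <= 0 ->
  gsum L (fun j k => lw v al be j k ^+ 2)
  + - al / 8 * \sum_(k < L) v 1 k.+1 ^+ 2
  + - be / 8 * \sum_(j < L) v j.+1 1 ^+ 2
  + be ^+ 2 / 32 * (al ^+ 2 + be ^+ 2) * \sum_(k < L) lap (v 1) k ^+ 2
  + al ^+ 2 / 32 * (al ^+ 2 + be ^+ 2) * \sum_(j < L) lap (v^~ 1) j ^+ 2
  <= gsum L (fun j k => v j.+1 k.+1 ^+ 2).
Proof.
move=> vG al0 be0.
(* The trace estimate for nonpositive coefficients. It is applied once per side, with [al] and [be]
   exchanged, and each side absorbs half of the corner term. *)
have tr (A B : R) f : A <= 0 -> B <= 0 -> A ^+ 2 + B ^+ 2 <= 1 / 2 ->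
    ghosted L f ->
  A * (\sum_(i < L) f i.+1 ^+ 2) + A * B ^+ 2 / 4 *
    (2 * \sum_(i < L) fdiff f i ^+ 2 - \sum_(i < L) lap f i ^+ 2)
  - B ^+ 2 / 16 * (\sum_(i < L) lap f i ^+ 2) + A * B / 2 * f 1 ^+ 2
  <= A / 8 * (\sum_(i < L) f i.+1 ^+ 2)
     - B ^+ 2 / 32 * (A ^+ 2 + B ^+ 2) * \sum_(i < L) lap f i ^+ 2.
  move=> A0 B0 AB fG.
  have := @trace_quadratic_le (- A) (- B) (\sum_(i < L) f i.+1 ^+ 2)
    (\sum_(i < L) fdiff f i ^+ 2) (\sum_(i < L) lap f i ^+ 2) (f 1 ^+ 2).
  rewrite !oppr_ge0 !sqrrN sum_lap_sqr_le// sum_fdiff_sqr_le//.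
  rewrite first_sqr_le_sum// sqr_ge0 sumr_ge0; last first.
    by move=> i _; rewrite sqr_ge0.
  by move=> /(_ A0 B0 AB isT isT isT); lra.
have := tr al be (v 1) al0 be0 CFL (vG.2 1).
have := tr be al (v^~ 1) be0 al0; rewrite addrC => /(_ CFL (vG.1 1)).
have := gsum_lwX_sqr_le vG; have := gsum_lw_sqr vG al be.
by move=> /=; lra.
Qed.

End EnergyInequalityOnBox.

(** * Passage to the quarter space *)

Section BoxExhaustion.
Variable R : realType.
Implicit Types (a : nat -> nat -> R).

Lemma ler_sum_widen (f : nat -> R) m n : (m <= n)%N -> (forall i, 0 <= f i) ->
  \sum_(i < m) f i <= \sum_(i < n) f i.
Proof.
move=> mn f0; rewrite (big_ord_widen _ f mn).
rewrite [leRHS](bigID (fun i : 'I_n => (i < m)%N)) /=.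
by rewrite lerDl sumr_ge0.
Qed.

Lemma ler_gsum_widen a m n : (m <= n)%N -> (forall j k, 0 <= a j k) ->
  gsum m a <= gsum n a.
Proof.
move=> mn a0; apply: (@le_trans _ _ (\sum_(j < m) \sum_(k < n) a j k)).
  by apply: ler_sum => j _; exact: ler_sum_widen.
apply: (@ler_sum_widen (fun j => \sum_(k < n) a j k)) => // j.
exact: sumr_ge0.
Qed.

Lemma EFin_gsum a n :
  (gsum n a)%:E = (\sum_(0 <= j < n) \sum_(0 <= k < n) (a j k)%:E)%E.
Proof.
rewrite big_mkord /gsum -sumEFin; apply: eq_bigr => j _.
by rewrite big_mkord sumEFin.
Qed.

(** Nonnegativity turns the unordered sum into an iterated series and makes the box sums increasing,
    so it remains to identify their supremum. *)
Lemma cvg_gsum_esum a : (forall j k, 0 <= a j k) ->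
  (gsum n a)%:E @[n --> \oo] -->
  (\esum_(p in [set: nat * nat]) (a p.1 p.2)%:E)%E.
Proof.
move=> a0.
have aE0 j k : (0 <= (a j k)%:E)%E by rewrite lee_fin.
have -> : (\esum_(p in [set: nat * nat]) (a p.1 p.2)%:E)%E =
    (\sum_(0 <= j <oo) \sum_(0 <= k <oo) (a j k)%:E)%E.
  rewrite nneseries_esumT; last by move=> j; exact: nneseries_ge0.
  under [RHS]eq_esum do rewrite nneseries_esumT//.
  rewrite (esum_esum (J := fun=> setT))//; congr esum.
  by apply/seteqP; split.
have nd : nondecreasing_seq (fun n => (gsum n a)%:E).
  by move=> m n mn; rewrite lee_fin ler_gsum_widen.
suff -> : (\sum_(0 <= j <oo) \sum_(0 <= k <oo) (a j k)%:E)%E =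
    ereal_sup (range (fun n => (gsum n a)%:E)).
  exact: ereal_nondecreasing_cvgn.
apply/eqP; rewrite eq_le; apply/andP; split; last first.
  apply: ge_ereal_sup => _ [n _ <-]; rewrite EFin_gsum.
  apply: (@le_trans _ _ (\sum_(0 <= j < n) \sum_(0 <= k <oo) (a j k)%:E)%E).
    by apply: lee_sum => j _; exact: nneseries_lim_ge.
  by apply: nneseries_lim_ge => j _ _; exact: nneseries_ge0.
apply: lime_le; first by apply: is_cvg_nneseries => j _ _; exact: nneseries_ge0.
apply: nearW => m; rewrite -nneseries_sum//.
apply: lime_le; first by apply: is_cvg_nneseries => j _ _; exact: sume_ge0.
apply: nearW => n; rewrite exchange_big /=.
(* Every [m] by [n] rectangle lies in a square box. *)
apply: (@le_trans _ _ (gsum (maxn m n) a)%:E); last first.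
  by apply: ereal_sup_ubound; exists (maxn m n).
rewrite EFin_gsum.
apply: (@le_trans _ _
  (\sum_(0 <= j < m) \sum_(0 <= k < maxn m n) (a j k)%:E)%E).
  apply: lee_sum => j _; apply: lee_sum_nneg_natr => //; exact: leq_maxr.
apply: lee_sum_nneg_natr; [by move=> j _ _; exact: sume_ge0|exact: leq_maxl].
Qed.

Lemma cvg_sum_nneseries (f : nat -> R) : (forall i, 0 <= f i) ->
  (\sum_(i < n) f i)%:E @[n --> \oo] --> (\sum_(0 <= i <oo) (f i)%:E)%E.
Proof.
move=> f0.
have -> : (fun n => (\sum_(i < n) f i)%:E) =
    (fun n => (\sum_(0 <= i < n) (f i)%:E)%E).
  by apply/funext => n; rewrite big_mkord sumEFin.
by apply: is_cvg_nneseries => i _ _; rewrite lee_fin.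
Qed.

End BoxExhaustion.

(** * Truncation of a grid and limit of the energy inequality *)

Section QuarterSpace.
Variable R : realType.
Implicit Types (u w : grid R).

Lemma sqnormH_ge0 u : (0 <= sqnormH u)%E.
Proof. by apply: esum_ge0 => p _; rewrite lee_fin sqr_ge0. Qed.

(* Index i of the truncated grid is index i - 1 of [u], so that row and column
   0 hold the ghost values. *)
Definition truncation u (M i k : nat) : R :=
  if (i <= M.+1)%N && (k <= M.+1)%N then u (i%:Z - 1) (k%:Z - 1) else 0.

Lemma predzS (i : nat) : i.+1%:Z - 1 = i%:Z.
Proof. by rewrite intS addrAC subrr add0r. Qed.

Lemma predzSS (i : nat) : i.+2%:Z - 1 = i%:Z + 1.
Proof. by rewrite predzS intS addrC. Qed.

(** The last index kept is [M.+1], so [M.+2] and [M.+3] carry the two zeros required at the far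
    end. *)
Lemma ghosted2_truncation u M : extrapolation_conditions u ->
  ghosted2 M.+2 (truncation u M).
Proof.
move=> [u1 u2].
have u1' k : u (-1) (k%:Z - 1) = u 0 (k%:Z - 1).
  by apply: u1; rewrite lerBrDr addNr.
have u2' j : u (j%:Z - 1) (-1) = u (j%:Z - 1) 0.
  (* The case of index 0 is the corner, where both values reduce to [u 0 0]. *)
  case: j => [|j]; last by rewrite predzS u2.
  by rewrite sub0r !u1// u2.
by split=> i; split; rewrite /truncation ?ltnn ?ltnNge ?leqnSn ?andbF//=
  !subrr !sub0r ?u1' ?u2'.
Qed.

(** The stencil reaches at most the indices [j.+2] and [k.+2], which the truncation still keeps. *)
Lemma lw_truncation a b lambda mu u M j k : (j < M)%N -> (k < M)%N ->
  lw (truncation u M) (lambda * a) (mu * b) j k =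
  lax_wendroff a b lambda mu u j%:Z k%:Z.
Proof.
move=> jM kM; rewrite /lw /lwX /lax_wendroff /D1 /D2 /L1 /L2 /D12 /L12.
rewrite /cdiff /lap /truncation !ltnS jM kM (ltnW jM) (ltnW kM).
rewrite (leqW (ltnW jM)) (leqW (ltnW kM)) /= !predzSS !predzS.
by field.
Qed.

Lemma gsum_le_sqnormH u n :
  ((gsum n (fun j k => u j%:Z k%:Z ^+ 2))%:E <= sqnormH u)%E.
Proof.
have cv : (gsum n (fun j k => u j%:Z k%:Z ^+ 2))%:E @[n --> \oo] --> sqnormH u.
  by apply: cvg_gsum_esum => j k; exact: sqr_ge0.
apply: (cvge_ge _ cv); exists n => // m /= nm.
by rewrite lee_fin ler_gsum_widen// => j k; exact: sqr_ge0.
Qed.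

(** The step of the truncated grid agrees with the scheme only below [M]. The other terms on the
    left of the box inequality are nonnegative and are dropped; on the right, truncation only lowers
    squares. *)
Lemma energy_inequality_truncated (a b lambda mu : R) u w M :
    a < 0 -> b < 0 -> 0 < lambda -> 0 < mu ->
    (lambda * a) ^+ 2 + (mu * b) ^+ 2 <= 1 / 2 ->
    extrapolation_conditions u ->
    (forall j k : nat, w j%:Z k%:Z = lax_wendroff a b lambda mu u j%:Z k%:Z) ->
  gsum M (fun j k => w j%:Z k%:Z ^+ 2)
  + lambda * `|a| / 8 * \sum_(k < M) u 0 k%:Z ^+ 2
  + mu * `|b| / 8 * \sum_(j < M) u j%:Z 0 ^+ 2
  + (mu * b) ^+ 2 / 32 * ((lambda * a) ^+ 2 + (mu * b) ^+ 2)
    * \sum_(k < M) Delta2 u 0 k%:Z ^+ 2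
  + (lambda * a) ^+ 2 / 32 * ((lambda * a) ^+ 2 + (mu * b) ^+ 2)
    * \sum_(j < M) Delta1 u j%:Z 0 ^+ 2
  <= gsum M.+2 (fun j k => u j%:Z k%:Z ^+ 2).
Proof.
move=> a0 b0 l0 m0 CFL uX wE; set v := truncation u M.
have la0 : lambda * a <= 0 by rewrite ltW// pmulr_rlt0.
have mb0 : mu * b <= 0 by rewrite ltW// pmulr_rlt0.
have MM : (M <= M.+2)%N by rewrite -addn2 leq_addr.
have box := energy_inequality_on_box CFL (ghosted2_truncation M uX) la0 mb0.
have -> : lambda * `|a| / 8 = - (lambda * a) / 8 by rewrite ltr0_norm// mulrN.
have -> : mu * `|b| / 8 = - (mu * b) / 8 by rewrite ltr0_norm// mulrN.
have sum_le (f g : nat -> R) : (forall i, (i < M)%N -> f i = g i) ->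
    \sum_(i < M) f i ^+ 2 <= \sum_(i < M.+2) g i ^+ 2.
  move=> fg; rewrite (eq_bigr (fun i : 'I_M => g i ^+ 2)).
    by apply: (@ler_sum_widen _ (fun i => g i ^+ 2)) => // i; exact: sqr_ge0.
  by move=> i _; rewrite fg.
have v1E k : (k < M.+2)%N -> v 1 k = u 0 (k%:Z - 1).
  by rewrite ltnS => kM; rewrite /v /truncation kM subrr.
have vE1 j : (j < M.+2)%N -> v j 1 = u (j%:Z - 1) 0.
  by rewrite ltnS => jM; rewrite /v /truncation jM subrr.
have lw_le : gsum M (fun j k => w j%:Z k%:Z ^+ 2) <=
    gsum M.+2 (fun j k => lw v (lambda * a) (mu * b) j k ^+ 2).
  rewrite (_ : gsum M _ =
    gsum M (fun j k => lw v (lambda * a) (mu * b) j k ^+ 2)).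
    by apply: ler_gsum_widen => // j k; exact: sqr_ge0.
  apply: eq_bigr => j _; apply: eq_bigr => k _.
  by rewrite wE -(lw_truncation _ _ _ _ _ (ltn_ord j) (ltn_ord k)).
have u_le : gsum M.+2 (fun j k => v j.+1 k.+1 ^+ 2) <=
    gsum M.+2 (fun j k => u j%:Z k%:Z ^+ 2).
  apply: ler_gsum => j k; rewrite /v /truncation !predzS.
  by case: ifP => // _; rewrite expr0n sqr_ge0.
have lt2 i : (i < M)%N -> [/\ (i < M.+2)%N, (i.+1 < M.+2)%N & (i.+2 < M.+2)%N].
  by move=> iM; rewrite !ltnS iM (ltnW iM) (leqW (ltnW iM)).
have W_le : \sum_(k < M) u 0 k%:Z ^+ 2 <= \sum_(k < M.+2) v 1 k.+1 ^+ 2.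
  apply: (sum_le (fun k => u 0 k%:Z) (fun k => v 1 k.+1)) => k /lt2[_ k1 _].
  by rewrite v1E// predzS.
have Z_le : \sum_(j < M) u j%:Z 0 ^+ 2 <= \sum_(j < M.+2) v j.+1 1 ^+ 2.
  apply: (sum_le (fun j => u j%:Z 0) (fun j => v j.+1 1)) => j /lt2[_ j1 _].
  by rewrite vE1// predzS.
have DW_le : \sum_(k < M) Delta2 u 0 k%:Z ^+ 2 <=
    \sum_(k < M.+2) lap (v 1) k ^+ 2.
  apply: (sum_le (fun k => Delta2 u 0 k%:Z) (fun k => lap (v 1) k)).
  move=> k /lt2[? ? ?].
  by rewrite /lap !v1E// predzSS predzS.
have DZ_le : \sum_(j < M) Delta1 u j%:Z 0 ^+ 2 <=
    \sum_(j < M.+2) lap (v^~ 1) j ^+ 2.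
  apply: (sum_le (fun j => Delta1 u j%:Z 0) (fun j => lap (v^~ 1) j)).
  move=> j /lt2[? ? ?].
  by rewrite /lap !vE1// predzSS predzS.
apply: le_trans u_le; apply: le_trans box.
have s0 : 0 <= (lambda * a) ^+ 2 + (mu * b) ^+ 2 by rewrite addr_ge0 ?sqr_ge0.
rewrite !lerD//; apply: ler_wpM2l => //.
- by rewrite divr_ge0// oppr_ge0.
- by rewrite divr_ge0// oppr_ge0.
- by rewrite mulr_ge0// divr_ge0// sqr_ge0.
- by rewrite mulr_ge0// divr_ge0// sqr_ge0.
Qed.

Lemma energy_inequality (a b lambda mu : R) u w :
    a < 0 -> b < 0 -> 0 < lambda -> 0 < mu ->
    (lambda * a) ^+ 2 + (mu * b) ^+ 2 <= 1 / 2 ->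
    extrapolation_conditions u ->
    (forall j k : nat, w j%:Z k%:Z = lax_wendroff a b lambda mu u j%:Z k%:Z) ->
  (sqnormH w
   + (lambda * `|a| / 8)%:E * (\sum_(0 <= k <oo) ((u 0%R k%:Z) ^+ 2)%:E)
   + (mu * `|b| / 8)%:E * (\sum_(0 <= j <oo) ((u j%:Z 0%R) ^+ 2)%:E)
   + ((mu * b) ^+ 2 / 32 * ((lambda * a) ^+ 2 + (mu * b) ^+ 2))%:E
     * (\sum_(0 <= k <oo) ((Delta2 u 0%R k%:Z) ^+ 2)%:E)
   + ((lambda * a) ^+ 2 / 32 * ((lambda * a) ^+ 2 + (mu * b) ^+ 2))%:E
     * (\sum_(0 <= j <oo) ((Delta1 u j%:Z 0%R) ^+ 2)%:E)
   <= sqnormH u)%E.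
Proof.
move=> a0 b0 l0 m0 CFL uX wE.
have s0 : 0 <= (lambda * a) ^+ 2 + (mu * b) ^+ 2 by rewrite addr_ge0 ?sqr_ge0.
have trunc M := energy_inequality_truncated M a0 b0 l0 m0 CFL uX wE.
have cvgS : (gsum n (fun j k => w j%:Z k%:Z ^+ 2))%:E @[n --> \oo] -->
    sqnormH w.
  by apply: cvg_gsum_esum => j k; exact: sqr_ge0.
have cvgZ (c : R) (f : nat -> R) :
    (c * \sum_(i < n) f i ^+ 2)%:E @[n --> \oo] -->
    (c%:E * \sum_(0 <= i <oo) (f i ^+ 2)%:E)%E.
  under eq_fun do rewrite EFinM.
  by apply: cvgeZl => //; apply: cvg_sum_nneseries => i; exact: sqr_ge0.
have ge0 (c : R) (f : nat -> R) : 0 <= c ->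
    (0 <= c%:E * \sum_(0 <= i <oo) (f i ^+ 2)%:E)%E.
  move=> c0; rewrite mule_ge0 ?lee_fin// nneseries_ge0// => i _ _.
  by rewrite lee_fin sqr_ge0.
have c1 : 0 <= lambda * `|a| / 8 by rewrite divr_ge0// mulr_ge0// ltW.
have c2 : 0 <= mu * `|b| / 8 by rewrite divr_ge0// mulr_ge0// ltW.
have c3 (c : R) : 0 <= c ^+ 2 / 32 * ((lambda * a) ^+ 2 + (mu * b) ^+ 2).
  by rewrite mulr_ge0// divr_ge0// sqr_ge0.
apply: (cvge_le _ (cvgeD _ (cvgeD _ (cvgeD _ (cvgeD _ cvgS
  (cvgZ _ (fun k => u 0 k%:Z))) (cvgZ _ (fun j => u j%:Z 0)))
  (cvgZ _ (fun k => Delta2 u 0 k%:Z))) (cvgZ _ (fun j => Delta1 u j%:Z 0)))).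
- apply: nearW => n; apply: le_trans (gsum_le_sqnormH u n.+2).
  by rewrite /= -!EFinD lee_fin; exact: trunc.
(* Limits add in the extended reals because every term is nonnegative. *)
all: by rewrite ge0_adde_def ?inE ?adde_ge0 ?ge0 ?sqnormH_ge0.
Qed.

End QuarterSpace.

(** * Energy decay at each step and its sum over all time steps *)

Theorem theorem4p1 (R : realType) (a b lambda mu : R)
    (ha : a < 0) (hb : b < 0) (hlambda : 0 < lambda) (hmu : 0 < mu)
    (hCFL : (lambda * a) ^+ 2 + (mu * b) ^+ 2 <= 1 / 2)
    (u : nat -> grid R) (hu : scheme_solution a b lambda mu u) :
  (forall n : nat,
    (sqnormH (u n.+1) - sqnormH (u n)
     + (lambda * `|a| / 8)%:E * (\sum_(0 <= k <oo) ((u n 0%R k%:Z) ^+ 2)%:E)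
     + (mu * `|b| / 8)%:E * (\sum_(0 <= j <oo) ((u n j%:Z 0%R) ^+ 2)%:E)
     + ((mu * b) ^+ 2 / 32 * ((lambda * a) ^+ 2 + (mu * b) ^+ 2))%:E
       * (\sum_(0 <= k <oo) ((Delta2 (u n) 0%R k%:Z) ^+ 2)%:E)
     + ((lambda * a) ^+ 2 / 32 * ((lambda * a) ^+ 2 + (mu * b) ^+ 2))%:E
       * (\sum_(0 <= j <oo) ((Delta1 (u n) j%:Z 0%R) ^+ 2)%:E)
     <= 0)%E)
  /\
  (ereal_sup [set sqnormH (u n) | n in [set: nat]]
   + (lambda * `|a| / 8)%:E
     * (\sum_(0 <= n <oo) \sum_(0 <= k <oo) ((u n 0%R k%:Z) ^+ 2)%:E)
   + (mu * `|b| / 8)%:E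
     * (\sum_(0 <= n <oo) \sum_(0 <= j <oo) ((u n j%:Z 0%R) ^+ 2)%:E)
   + ((mu * b) ^+ 2 / 32 * ((lambda * a) ^+ 2 + (mu * b) ^+ 2))%:E
     * (\sum_(0 <= n <oo) \sum_(0 <= k <oo) ((Delta2 (u n) 0%R k%:Z) ^+ 2)%:E)
   + ((lambda * a) ^+ 2 / 32 * ((lambda * a) ^+ 2 + (mu * b) ^+ 2))%:E
     * (\sum_(0 <= n <oo) \sum_(0 <= j <oo) ((Delta1 (u n) j%:Z 0%R) ^+ 2)%:E)
   <= 2%:E * sqnormH (u 0%N))%E.
Proof.
have [_ uX uS] := hu.
have step n := energy_inequality ha hb hlambda hmu hCFL (uX n) (uS n).
split=> [n|].
  by rewrite !(addeAC _ (- sqnormH (u n))%E) sube_le0.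
have s0 : 0 <= (lambda * a) ^+ 2 + (mu * b) ^+ 2 by rewrite addr_ge0 ?sqr_ge0.
pose S (f : nat -> nat -> R) n : \bar R :=
  (\sum_(0 <= k <oo) ((f n k) ^+ 2)%:E)%E.
have S0 f n : (0 <= S f n)%E.
  by apply: nneseries_ge0 => k _ _; rewrite lee_fin sqr_ge0.
set c1 := lambda * `|a| / 8 in step *; set c2 := mu * `|b| / 8 in step *.
set c3 := (mu * b) ^+ 2 / 32 * _ in step *.
set c4 := (lambda * a) ^+ 2 / 32 * _ in step *.
have c1_ge0 : 0 <= c1 by rewrite divr_ge0// mulr_ge0// ltW.
have c2_ge0 : 0 <= c2 by rewrite divr_ge0// mulr_ge0// ltW.
have c3_ge0 : 0 <= c3 by rewrite mulr_ge0// divr_ge0// sqr_ge0.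
have c4_ge0 : 0 <= c4 by rewrite mulr_ge0// divr_ge0// sqr_ge0.
(* The boundary dissipation at time [n]. *)
pose B n : \bar R := (c1%:E * S (fun n k => u n 0%R k%:Z) n
  + c2%:E * S (fun n j => u n j%:Z 0%R) n
  + c3%:E * S (fun n k => Delta2 (u n) 0%R k%:Z) n
  + c4%:E * S (fun n j => Delta1 (u n) j%:Z 0%R) n)%E.
have cS0 (c : R) f n : 0 <= c -> (0 <= c%:E * S f n)%E.
  by move=> c0; rewrite mule_ge0// lee_fin.
have B0 n : (0 <= B n)%E by rewrite !adde_ge0 ?cS0.
(* The one-step inequalities telescope in time; both bounds below drop one nonnegative part of this
   estimate. *)
have energy n : (sqnormH (u n) + \sum_(0 <= i < n) B i <= sqnormH (u 0%N))%E.
  elim: n => [|n IHn]; first by rewrite big_geq// adde0.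
  rewrite big_nat_recr//= addeA addeAC; apply: le_trans IHn; apply: leeD2r.
  by rewrite /B !addeA; exact: step.
have sup_le : (ereal_sup [set sqnormH (u n) | n in [set: nat]] <=
    sqnormH (u 0%N))%E.
  apply: ge_ereal_sup => _ [n _ <-]; apply: le_trans (energy n).
  by rewrite leeDl// sume_ge0.
have B_le : (\sum_(0 <= n <oo) B n <= sqnormH (u 0%N))%E.
  apply: lime_le; first exact: is_cvg_nneseries.
  by apply: nearW => n; apply: le_trans (energy n); rewrite leeDr// sqnormH_ge0.
(* The factor 2 arises here: one copy of the initial energy bounds the supremum, the other the total
   dissipation. *)
rewrite mule_natl mule2n -!addeA; apply: leeD => //; apply: le_trans B_le.
rewrite /B !nneseriesD ?nneseriesZl ?addeA// => n *; rewrite ?adde_ge0 ?cS0//.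
Qed.
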